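(* Every subgroup of $\mathrm{Isom}^+(\mathbb{H}^3)\cong PSL(2,\mathbb{C})$ generated by two non-identity isometries is conjugate to a group of the form $\langle f,g\rangle$, where $f$ and $g$ are represented in $PSL(2,\mathbb{C})$ by matrices $A$ and $B$ respectively such that, writing $\beta=\beta(f)$, $\beta'=\beta(g)$, $\gamma=\gamma(f,g)$, one of the following holds. Case 1 ($\beta\neq 0$, i.e. $f$ non-parabolic): $$A=\begin{pmatrix}\frac{\sqrt{\beta(\beta+4)}+\beta}{2\sqrt{\beta}}&0\\0&\frac{\sqrt{\beta(\beta+4)}-\beta}{2\sqrt{\beta}}\end{pmatrix},\qquad B=\begin{pmatrix}a&b\\c&d\end{pmatrix},$$ $$a=\tfrac12\Big(\sqrt{\beta'+4}+\sqrt{\tfrac{4\gamma+\beta\beta'}{\beta}}\Big),\qquad d=\tfrac12\Big(\sqrt{\beta'+4}-\sqrt{\tfrac{4\gamma+\beta\beta'}{\beta}}\Big),$$ and $c=-b=\sqrt{\gamma/\beta}$ when $\gamma\neq0$, while when $\gamma=0$ either ($b=0$, $c=1$) or ($b=1$, $c=0$) or ($b=c=0$). Case 2 ($\beta=0$ and $\gamma\neq0$): $$A=\begin{pmatrix}1&1\\0&1\end{pmatrix},\qquad B=\begin{pmatrix}0&-1/\sqrt{\gamma}\\ \sqrt{\gamma}&\sqrt{\beta'+4}\end{pmatrix}.$$ Case 3 ($\beta=\gamma=0$): $$A=\begin{pmatrix}1&1\\0&1\end{pmatrix},\qquad B=\begin{pmatrix}\frac12[\sqrt{\beta'+4}+\sqrt{\beta'}]&\ell\\0&\frac12[\sqrt{\beta'+4}-\sqrt{\beta'}]\end{pmatrix},$$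 where $\ell=0$ when $\beta'\neq0$, and $\ell$ can take any complex value when $\beta'=0$.
   Context: $\mathrm{Isom}^+(\mathbb{H}^3)$ is the group of orientation-preserving isometries of hyperbolic 3-space, identified with $PSL(2,\mathbb{C})$. For isometries $f,g$ represented by matrices $A,B\in SL(2,\mathbb{C})$ (determined up to sign), $\beta(f)=\mathrm{tr}^2(A)-4$ and $\gamma(f,g)=\mathrm{tr}(ABA^{-1}B^{-1})-2$. All square roots are principal values. A non-identity $f$ is parabolic if and only if $\beta(f)=0$. *)

(* Defs.v *)
From HB Require Import structures.
From mathcomp Require Import all_boot all_order all_algebra.
From mathcomp Require Import classical_sets reals.
From mathcomp Require Export complex.

Set Implicit Arguments.
Unset Strict Implicit.
Unset Printing Implicit Defensive.
Import Order.TTheory GRing.Theory Num.Theory.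
Local Open Scope ring_scope.

(* Note on square roots: [sqrtc] from real_closed.complex is the principal
   square root on R[i] (nonnegative real part, and nonnegative imaginary part
   on the cut), unlike [sqrtC], whose argument lies in [0, pi). *)

Definition mx2 (F : nzRingType) (a b c d : F) : 'M[F]_2 :=
  \matrix_(i < 2, j < 2)
    if i == 0 then (if j == 0 then a else b) else (if j == 0 then c else d).

Section SL2.
Variable F : fieldType.

Record SL2 := MkSL2 { SL2_mx :> 'M[F]_2; _ : \det SL2_mx == 1 }.

HB.instance Definition _ := [isSub for SL2_mx].
HB.instance Definition _ := [Choice of SL2 by <:].

Implicit Types A B C : SL2.

Lemma SL2_det A : \det A = 1.
Proof. by case: A => A /= /eqP. Qed.

Lemma SL2_unit A : (A : 'M_2) \in unitmx.
Proof. by rewrite unitmxE SL2_det unitr1. Qed.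

Fact SL2_one_det : \det (1%:M : 'M[F]_2) == 1.
Proof. by rewrite det1. Qed.
Fact SL2_mul_det A B : \det (A *m B) == 1.
Proof. by rewrite det_mulmx !SL2_det mulr1. Qed.
Fact SL2_inv_det A : \det (invmx A) == 1.
Proof. by rewrite det_inv SL2_det invr1. Qed.
Fact SL2_opp_det A : \det (- (A : 'M_2)) == 1.
Proof. by rewrite -scaleN1r detZ SL2_det sqrrN expr1n mulr1. Qed.

Definition SL2_one := MkSL2 SL2_one_det.
Definition SL2_mul A B := MkSL2 (SL2_mul_det A B).
Definition SL2_inv A := MkSL2 (SL2_inv_det A).
Definition SL2_opp A := MkSL2 (SL2_opp_det A).

Fact SL2_mulA : associative SL2_mul.
Proof. by move=> A B C; apply: val_inj; rewrite /= mulmxA. Qed.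
Fact SL2_mul1 : left_id SL2_one SL2_mul.
Proof. by move=> A; apply: val_inj; rewrite /= mul1mx. Qed.
Fact SL2_1mul : right_id SL2_one SL2_mul.
Proof. by move=> A; apply: val_inj; rewrite /= mulmx1. Qed.
Fact SL2_mulV : left_inverse SL2_one SL2_inv SL2_mul.
Proof. by move=> A; apply: val_inj; rewrite /= mulVmx ?SL2_unit. Qed.
Fact SL2_Vmul : right_inverse SL2_one SL2_inv SL2_mul.
Proof. by move=> A; apply: val_inj; rewrite /= mulmxV ?SL2_unit. Qed.

HB.instance Definition _ :=
  isGroup.Build SL2 SL2_mulA SL2_mul1 SL2_1mul SL2_mulV SL2_Vmul.

Definition SL2_eqpm A B : bool := (A == B) || (A == SL2_opp B).

Lemma SL2_oppK : involutive SL2_opp.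
Proof. by move=> A; apply: val_inj; rewrite /= opprK. Qed.

Fact SL2_eqpm_refl : reflexive SL2_eqpm.
Proof. by move=> A; rewrite /SL2_eqpm eqxx. Qed.
Fact SL2_eqpm_sym : symmetric SL2_eqpm.
Proof.
by move=> A B; rewrite /SL2_eqpm eq_sym -(inv_eq SL2_oppK) [SL2_opp A == B]eq_sym.
Qed.
Fact SL2_eqpm_trans : transitive SL2_eqpm.
Proof.
move=> B A C /orP[]/eqP-> // /orP[]/eqP->; rewrite /SL2_eqpm ?SL2_oppK eqxx //.
by rewrite orbT.
Qed.

Canonical SL2_eqpm_equiv :=
  EquivRel SL2_eqpm SL2_eqpm_refl SL2_eqpm_sym SL2_eqpm_trans.

Definition PSL2 := {eq_quot SL2_eqpm}%qT.
HB.instance Definition _ := Choice.on PSL2.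
HB.instance Definition _ := EqQuotient.on PSL2.

Definition toPSL2 A : PSL2 := \pi_PSL2%qT A.

Lemma toPSL2P A B : reflect (A = B \/ A = SL2_opp B) (toPSL2 A == toPSL2 B).
Proof.
rewrite /toPSL2 eqquotE.
by apply: (iffP orP) => -[/eqP|/eqP]; auto.
Qed.

Lemma toPSL2_opp A : toPSL2 (SL2_opp A) = toPSL2 A.
Proof. by apply/eqP/toPSL2P; right. Qed.

Lemma repr_toPSL2 A :
  repr (toPSL2 A) = A \/ repr (toPSL2 A) = SL2_opp A.
Proof. by apply/toPSL2P; rewrite /toPSL2 reprK. Qed.

Lemma reprPSL2K (f : PSL2) : toPSL2 (repr f) = f.
Proof. exact: reprK. Qed.

Definition PSL2_one : PSL2 := toPSL2 1%g.
Definition PSL2_mul (f g : PSL2) : PSL2 := toPSL2 (repr f * repr g)%g.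
Definition PSL2_inv (f : PSL2) : PSL2 := toPSL2 (repr f)^-1%g.

Lemma SL2_mulN A B : (A * SL2_opp B)%g = SL2_opp (A * B)%g.
Proof. by apply: val_inj; rewrite /= mulmxN. Qed.
Lemma SL2_mulNl A B : (SL2_opp A * B)%g = SL2_opp (A * B)%g.
Proof. by apply: val_inj; rewrite /= mulNmx. Qed.
Lemma SL2_invN A : ((SL2_opp A)^-1)%g = SL2_opp (A^-1)%g.
Proof.
apply: (mulgI (SL2_opp A)); rewrite mulgV SL2_mulN SL2_mulNl SL2_oppK.
by rewrite mulgV.
Qed.

Lemma toPSL2_mul A B : PSL2_mul (toPSL2 A) (toPSL2 B) = toPSL2 (A * B)%g.
Proof.
rewrite /PSL2_mul; case: (repr_toPSL2 A) => ->; case: (repr_toPSL2 B) => ->;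
by rewrite ?SL2_mulN ?SL2_mulNl ?toPSL2_opp.
Qed.
Lemma toPSL2_inv A : PSL2_inv (toPSL2 A) = toPSL2 (A^-1)%g.
Proof.
by rewrite /PSL2_inv; case: (repr_toPSL2 A) => ->; rewrite ?SL2_invN ?toPSL2_opp.
Qed.

Fact PSL2_mulA : associative PSL2_mul.
Proof.
move=> f g h; rewrite -(reprPSL2K f) -(reprPSL2K g) -(reprPSL2K h).
by rewrite !toPSL2_mul mulgA.
Qed.
Fact PSL2_mul1 : left_id PSL2_one PSL2_mul.
Proof. by move=> f; rewrite -(reprPSL2K f) toPSL2_mul mul1g. Qed.
Fact PSL2_1mul : right_id PSL2_one PSL2_mul.
Proof. by move=> f; rewrite -(reprPSL2K f) toPSL2_mul mulg1. Qed.
Fact PSL2_mulV : left_inverse PSL2_one PSL2_inv PSL2_mul.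
Proof. by move=> f; rewrite -(reprPSL2K f) toPSL2_inv toPSL2_mul mulVg. Qed.
Fact PSL2_Vmul : right_inverse PSL2_one PSL2_inv PSL2_mul.
Proof. by move=> f; rewrite -(reprPSL2K f) toPSL2_inv toPSL2_mul mulgV. Qed.

HB.instance Definition _ :=
  isGroup.Build PSL2 PSL2_mulA PSL2_mul1 PSL2_1mul PSL2_mulV PSL2_Vmul.

(* beta and gamma are computed on a choice of representatives; betaE and
   gammaE show that the choice is immaterial. *)
Definition beta (f : PSL2) : F := (\tr (repr f)) ^+ 2 - 4.
Definition gamma (f g : PSL2) : F :=
  \tr (repr f * repr g * (repr f)^-1 * (repr g)^-1)%g - 2.

Lemma betaE A : beta (toPSL2 A) = (\tr A) ^+ 2 - 4.
Proof.
rewrite /beta; case: (repr_toPSL2 A) => -> //.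
by rewrite /= raddfN sqrrN.
Qed.

Lemma gammaE A B :
  gamma (toPSL2 A) (toPSL2 B) = \tr (A * B * A^-1 * B^-1)%g - 2.
Proof.
rewrite /gamma; case: (repr_toPSL2 A) => ->; case: (repr_toPSL2 B) => ->;
by rewrite ?(SL2_invN, SL2_mulN, SL2_mulNl, SL2_oppK).
Qed.

End SL2.

Section Subgroups.
Local Open Scope classical_set_scope.
Variable G : groupType.

Definition is_subgroup (H : set G) : Prop :=
  H 1%g /\ forall x y, H x -> H y -> H (x * y^-1)%g.

Definition gen2 (f g : G) : set G := smallest is_subgroup [set f; g].

Definition conjugate (H K : set G) : Prop :=
  exists h : G, K = [set (x ^ h)%g | x in H].

End Subgroups.

Section NormalForms.
Variable R : realType.
Local Notation C := R[i].
Local Notation sqrt := (@sqrtc R).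

Definition case1_form (A B : 'M[C]_2) (b1 b2 gam : C) : Prop :=
  A = mx2 ((sqrt (b1 * (b1 + 4)) + b1) / (2 * sqrt b1)) 0
          0 ((sqrt (b1 * (b1 + 4)) - b1) / (2 * sqrt b1))
  /\ exists b c : C,
      B = mx2 ((sqrt (b2 + 4) + sqrt ((4 * gam + b1 * b2) / b1)) / 2) b
              c ((sqrt (b2 + 4) - sqrt ((4 * gam + b1 * b2) / b1)) / 2)
      /\ (gam != 0 -> c = sqrt (gam / b1) /\ - b = sqrt (gam / b1))
      /\ (gam = 0 -> [\/ b = 0 /\ c = 1, b = 1 /\ c = 0 | b = 0 /\ c = 0]).

Definition case2_form (A B : 'M[C]_2) (b2 gam : C) : Prop :=
  A = mx2 1 1
          0 1
  /\ B = mx2 0 (- (1 / sqrt gam))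
             (sqrt gam) (sqrt (b2 + 4)).

Definition case3_form (A B : 'M[C]_2) (b2 : C) : Prop :=
  A = mx2 1 1
          0 1
  /\ exists l : C,
      B = mx2 ((sqrt (b2 + 4) + sqrt b2) / 2) l
              0 ((sqrt (b2 + 4) - sqrt b2) / 2)
      /\ (b2 != 0 -> l = 0).

End NormalForms.

(* Main.v *)
Require Import Defs.
From mathcomp Require Import all_boot all_order all_algebra.
From mathcomp Require Import classical_sets reals.
From mathcomp Require Import ring.

(** A marked pair (f, g) may be changed in three ways without leaving the
    conjugacy class of the group it generates: conjugate f and g
    simultaneously, replace f or g by its inverse, and replace the matrix
    representing f or g by its opposite.  These moves suffice to bring any
    pair with f <> 1 to one of the three forms; f can stay the first of the two
    given generators throughout.

    An eigenvector of f makes its matrix upper triangular, and then a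
    translation or a dilation makes it diag(x, y) with x <> y, or, up to sign,
    the unipotent matrix with upper right entry 1 ([normalizable_nontrivial],
    [normalizable_upper]).  What is left of the conjugation freedom is used
    on g.  When f is diagonal, further conjugation by diag(t, 1/t) multiplies c
    by an arbitrary nonzero factor and divides b by it
    ([normalizable_diag]); when f is unipotent, translations make the upper
    left entry of g zero, or its upper right entry zero if g is upper
    triangular with a <> d ([normalizable_parabolic]).

    In these coordinates the invariants are perfect squares of simple
    expressions in the entries: for f = diag(x, y) and g = (a, b; c, d),
    beta = (x - y)^2, beta' + 4 = (a + d)^2,
    (4 gamma + beta beta') / beta = (a - d)^2 and gamma / beta = - b c; for f
    unipotent, gamma = c^2, and beta' = (a - d)^2 as soon as c = 0.  So the
    normal forms are reached, up to the choice of signs of x - y, x^2 - y^2,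
    a + d, a - d and c.  The theorem asks that each of these be the principal
    square root of its square.  The signs are adjusted one by one, each
    by a move which keeps the signs fixed before: passing to opposite
    matrices, inverting a generator, and conjugating by the quarter turn that
    exchanges the two fixed points of a diagonal f. *)

Set Implicit Arguments.
Unset Strict Implicit.
Unset Printing Implicit Defensive.
Import GRing.Theory Num.Theory.
Local Open Scope ring_scope.
Local Open Scope complex_scope.

(** * Subgroups generated by two elements, up to conjugacy *)

Section Generation.
Variable G : groupType.
Implicit Types f g h x : G.
Local Open Scope classical_set_scope.

Lemma is_subgroup_gen2 f g : is_subgroup (gen2 f g).
Proof.
split=> [|x y Hx Hy] K [sgK fgK]; first by case: sgK.
by apply: sgK.2; [apply: Hx|apply: Hy].
Qed.

Lemma is_subgroupV (K : set G) x : is_subgroup K -> K x -> K x^-1%g.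
Proof. by case=> K1 Kdiv Kx; rewrite -[(x^-1)%g]mul1g; apply: Kdiv. Qed.

Lemma gen2_l f g : gen2 f g f.
Proof. by move=> K [_]; apply; left. Qed.

Lemma gen2_r f g : gen2 f g g.
Proof. by move=> K [_]; apply; right. Qed.

Lemma gen2_sub {f g} {K : set G} :
  is_subgroup K -> K f -> K g -> gen2 f g `<=` K.
Proof. by move=> sgK Kf Kg; apply: smallest_sub => // x [->|->]. Qed.

Lemma gen2Vl f g : gen2 f^-1%g g = gen2 f g.
Proof.
have sub f' : gen2 f'^-1%g g `<=` gen2 f' g.
  apply: gen2_sub (is_subgroup_gen2 _ _) _ (@gen2_r _ _).
  exact: is_subgroupV (is_subgroup_gen2 _ _) (@gen2_l _ _).
by apply/seteqP; split; [apply: sub|rewrite -{1}(invgK f); apply: sub].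
Qed.

Lemma gen2C f g : gen2 f g = gen2 g f.
Proof.
have sub f' g' : gen2 f' g' `<=` gen2 g' f'.
  exact: gen2_sub (is_subgroup_gen2 _ _) (@gen2_r _ _) (@gen2_l _ _).
by apply/seteqP.
Qed.

Lemma gen2Vr f g : gen2 f g^-1%g = gen2 f g.
Proof. by rewrite gen2C gen2Vl gen2C. Qed.

(** Conjugation by h is an automorphism, so it pulls subgroups back. *)
Lemma is_subgroup_preimJ (K : set G) h :
  is_subgroup K -> is_subgroup [set x | K (x ^ h)%g].
Proof.
case=> K1 Kdiv; split=> [|x y]; first by rewrite /= conj1g.
by rewrite /= conjMg conjVg; apply: Kdiv.
Qed.

Lemma gen2J f g h :
  gen2 (f ^ h)%g (g ^ h)%g = [set (x ^ h)%g | x in gen2 f g].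
Proof.
have sub f' g' h' :
    gen2 f' g' `<=` [set x | gen2 (f' ^ h')%g (g' ^ h')%g (x ^ h')%g].
  apply: gen2_sub; first exact: is_subgroup_preimJ (is_subgroup_gen2 _ _).
    exact: gen2_l.
  exact: gen2_r.
apply/seteqP; split=> [x Kx|_ [x Kx <-]]; last exact: sub.
exists (x ^ h^-1)%g; last by rewrite conjgKV.
by have /= := sub _ _ h^-1%g _ Kx; rewrite !conjgK.
Qed.

Lemma conjugate_refl (K : set G) : conjugate K K.
Proof.
exists 1%g; apply/seteqP; split=> [x Kx|_ [x Kx <-]]; last by rewrite conjg1.
by exists x; rewrite ?conjg1.
Qed.

Lemma conjugateJ f g h (K : set G) :
  conjugate (gen2 (f ^ h)%g (g ^ h)%g) K -> conjugate (gen2 f g) K.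
Proof.
case=> k ->; exists (h * k)%g; rewrite gen2J image_comp.
by apply: eq_imagel => x _ /=; rewrite conjgM.
Qed.

End Generation.

(** * Matrices of size two and the invariants beta and gamma *)

Section TwoByTwo.
Variable F : fieldType.
Implicit Types (A B : SL2 F) (M : 'M[F]_2).

Lemma ord2P (i : 'I_2) : i = 0 \/ i = 1.
Proof. by case: i => [[|[|//]] ?]; [left|right]; apply: val_inj. Qed.

Lemma mx2_entries M : M = mx2 (M 0 0) (M 0 1) (M 1 0) (M 1 1).
Proof.
apply/matrixP=> i j; rewrite !mxE.
by case: (ord2P i) => ->; case: (ord2P j) => ->.
Qed.

Lemma mulmx2 (a b c d a' b' c' d' : F) :
  mx2 a b c d *m mx2 a' b' c' d' =
  mx2 (a * a' + b * c') (a * b' + b * d') (c * a' + d * c') (c * b' + d * d').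
Proof.
apply/matrixP=> i j; rewrite !mxE !big_ord_recl big_ord0 !mxE addr0.
by case: (ord2P i) => ->; case: (ord2P j) => ->.
Qed.

Lemma tr_mx2 (a b c d : F) : \tr (mx2 a b c d) = a + d.
Proof. by rewrite /mxtrace !big_ord_recl big_ord0 !mxE addr0. Qed.

Lemma oppmx2 (a b c d : F) : - mx2 a b c d = mx2 (- a) (- b) (- c) (- d).
Proof. by apply/matrixP=> i j; rewrite !mxE; case: ifP; case: ifP. Qed.

Lemma det_mx2 (a b c d : F) : \det (mx2 a b c d) = a * d - b * c.
Proof.
rewrite (expand_det_row _ 0) !big_ord_recl big_ord0 /cofactor !det_mx11 !mxE /=.
by rewrite addr0 expr0 expr1 mul1r mulN1r mulrN.
Qed.

Lemma SL2_det_mx2 A (a b c d : F) :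
  A = mx2 a b c d :> 'M_2 -> a * d - b * c = 1.
Proof. by move=> defA; rewrite -det_mx2 -defA SL2_det. Qed.

Lemma SL2_inv_mx2 A (a b c d : F) :
  A = mx2 a b c d :> 'M_2 -> (A^-1)%g = mx2 d (- b) (- c) a :> 'M_2.
Proof.
move=> defA; have detA := SL2_det_mx2 defA.
have defI : mx2 d (- b) (- c) a *m A = 1%:M.
  rewrite defA mulmx2 [1%:M]mx2_entries !mxE /=.
  by congr mx2; rewrite -?detA; ring.
by rewrite -[RHS]mulmx1 -(mulmxV (SL2_unit A)) mulmxA defI mul1mx.
Qed.

Lemma beta_mx2 A (a b c d : F) :
  A = mx2 a b c d :> 'M_2 -> beta (toPSL2 A) = (a + d) ^+ 2 - 4.
Proof. by move=> defA; rewrite betaE defA tr_mx2. Qed.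

(** Fricke's identity
    tr [A, B] = tr(A)^2 + tr(B)^2 + tr(AB)^2 - tr(A) tr(B) tr(AB) - 2,
    with z standing for tr(AB). *)
Lemma gamma_mx2 A B (a b c d a' b' c' d' : F) :
    A = mx2 a b c d :> 'M_2 -> B = mx2 a' b' c' d' :> 'M_2 ->
  let z := a * a' + b * c' + c * b' + d * d' in
  gamma (toPSL2 A) (toPSL2 B) =
    (a + d) ^+ 2 + (a' + d') ^+ 2 + z ^+ 2 - (a + d) * (a' + d') * z - 4.
Proof.
move=> defA defB z; have detA := SL2_det_mx2 defA.
have detB := SL2_det_mx2 defB.
rewrite gammaE /=.
have -> : invmx A = mx2 d (- b) (- c) a by rewrite -(SL2_inv_mx2 defA).
have -> : invmx B = mx2 d' (- b') (- c') a' by rewrite -(SL2_inv_mx2 defB).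
rewrite defA defB !mulmx2 tr_mx2.
(* Weighting each term with the determinants gives an identity that holds for
   all matrices, with adjugates in place of inverses. *)
transitivity ((a' * d' - b' * c') * (a + d) ^+ 2
  + (a * d - b * c) * (a' + d') ^+ 2 + z ^+ 2 - (a + d) * (a' + d') * z
  - 2 * ((a * d - b * c) * (a' * d' - b' * c')) - 2).
  by rewrite /z; ring.
by rewrite detA detB; ring.
Qed.

End TwoByTwo.

(** * Principal square roots and admissible moves *)

Section NormalForm.
Variable R : realType.
Local Notation C := R[i].
Local Notation sqrt := (@sqrtc R).
Implicit Types (A B : SL2 C) (M N : 'M[C]_2).

(** The sign condition behind every square root of the theorem: an expression
    is the principal root of its square. *)
Definition principal (s : C) : Prop := sqrt (s ^+ 2) = s.

Lemma principal_or_opp s : principal s \/ principal (- s).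
Proof.
have /eqP := sqr_sqrtc (s ^+ 2); rewrite eqf_sqr /principal sqrrN.
by case/orP=> /eqP; [left|right].
Qed.

Lemma sqrtc_principal s : principal (sqrt s).
Proof. by rewrite /principal sqr_sqrtc. Qed.

Definition has_normal_form (f g : PSL2 C) : Prop :=
  exists A B : SL2 C, let f' := toPSL2 A in let g' := toPSL2 B in
    conjugate (gen2 f g) (gen2 f' g') /\
    [\/ beta f' != 0 /\ case1_form A B (beta f') (beta g') (gamma f' g'),
        beta f' = 0 /\ gamma f' g' != 0 /\
          case2_form A B (beta g') (gamma f' g')
      | beta f' = 0 /\ gamma f' g' = 0 /\ case3_form A B (beta g')].

(** Quantifying over the elements of SL2 with matrices M and N, instead of
    asking M and N to be elements of SL2, leaves entries free to be rewritten
    without transporting proofs about determinants. *)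
Definition normalizable M N : Prop :=
  forall A B, A = M :> 'M_2 -> B = N :> 'M_2 ->
    has_normal_form (toPSL2 A) (toPSL2 B).

Lemma normalizable_det (a b c d a' b' c' d' : C) :
    (a * d - b * c = 1 -> a' * d' - b' * c' = 1 ->
       normalizable (mx2 a b c d) (mx2 a' b' c' d')) ->
  normalizable (mx2 a b c d) (mx2 a' b' c' d').
Proof.
move=> nfMN A B defA defB.
exact: nfMN (SL2_det_mx2 defA) (SL2_det_mx2 defB) A B defA defB.
Qed.

Lemma normalizable_oppl M N : normalizable (- M) N -> normalizable M N.
Proof.
move=> nfMN A B defA defB; rewrite -toPSL2_opp.
by apply: nfMN; rewrite //= defA.
Qed.

Lemma normalizable_oppr M N : normalizable M (- N) -> normalizable M N.
Proof.
move=> nfMN A B defA defB; rewrite -(toPSL2_opp B).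
by apply: nfMN; rewrite //= defB.
Qed.

Lemma normalizable_invl (a b c d : C) N :
  normalizable (mx2 d (- b) (- c) a) N -> normalizable (mx2 a b c d) N.
Proof.
move=> nfMN A B defA defB.
have := nfMN _ B (SL2_inv_mx2 defA) defB.
by rewrite /has_normal_form -toPSL2_inv gen2Vl.
Qed.

Lemma normalizable_invr (a b c d : C) M :
  normalizable M (mx2 d (- b) (- c) a) -> normalizable M (mx2 a b c d).
Proof.
move=> nfMN A B defA defB.
have := nfMN A _ defA (SL2_inv_mx2 defB).
by rewrite /has_normal_form -toPSL2_inv gen2Vr.
Qed.

(** With P = (p, q; r, s), the equations P M' = M P and P N' = N P say that M'
    and N' are the conjugates of M and N by P, in a form that needs no
    inverse. *)
Lemma normalizable_conj (p q r s : C) M N M' N' : p * s - q * r = 1 ->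
    mx2 p q r s *m M' = M *m mx2 p q r s ->
    mx2 p q r s *m N' = N *m mx2 p q r s ->
  normalizable M' N' -> normalizable M N.
Proof.
move=> detP defM' defN' nfMN A B defA defB.
have detPb : \det (mx2 p q r s) == 1 by rewrite det_mx2 detP.
pose P := MkSL2 detPb.
have conjP (D : SL2 C) K K' : D = K :> 'M_2 -> P *m K' = K *m P ->
  (D ^ P)%g = K' :> 'M_2.
  move=> defD defK'; rewrite conjgE /= defD -[mx2 p q r s]/(SL2_mx P) -defK'.
  by rewrite mulmxA mulVmx ?mul1mx ?SL2_unit.
have [A' [B' [conjAB formAB]]] := nfMN _ _ (conjP _ _ _ defA defM')
                                          (conjP _ _ _ defB defN').
exists A', B'; split=> //; apply: (conjugateJ (h := toPSL2 P)).
have toPSL2J (D : SL2 C) : (toPSL2 D ^ toPSL2 P)%g = toPSL2 (D ^ P)%g.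
  rewrite !conjgE -[((toPSL2 P)^-1)%g]/(PSL2_inv _) toPSL2_inv.
  by rewrite -!toPSL2_mul.
by rewrite !toPSL2J.
Qed.

(** The variant for normalizing the first generator alone, the second being
    carried along to an unspecified matrix. *)
Lemma normalizable_conjl (p q r s : C) M M' : p * s - q * r = 1 ->
    mx2 p q r s *m M' = M *m mx2 p q r s ->
  (forall N', normalizable M' N') -> forall N, normalizable M N.
Proof.
move=> detP defM' nfM' N.
pose N' := mx2 s (- q) (- r) p *m (N *m mx2 p q r s).
apply: (normalizable_conj detP defM' _ (nfM' N')).
rewrite mulmxA mulmx2.
rewrite [X in X *m _](_ : _ = 1%:M) ?mul1mx // [RHS]mx2_entries !mxE /=.
by congr mx2; rewrite -?detP; ring.
Qed.

(** * Pairs already in normal form *)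

(** With k a determinant equal to 1, this turns the constant 4 into a quadratic
    form in the entries; the identities between traces then become homogeneous
    and hold in any commutative ring. *)
Fact mul4_eq1 (k : C) : k = 1 -> 4 * k = 4.
Proof. by move->; rewrite mulr1. Qed.

(** The conditions on x and y determine A: beta is (x - y)^2 and
    beta (beta + 4) is (x^2 - y^2)^2, so that x and y are recovered from the
    principal roots x - y and x^2 - y^2. *)
Lemma normalizable_case1 (x y a b c d : C) : x != y ->
    principal (x - y) -> principal (x ^+ 2 - y ^+ 2) ->
    principal (a + d) -> principal (a - d) ->
    (b * c != 0 -> principal c /\ - b = c) ->
    (b * c = 0 -> [\/ b = 0 /\ c = 1, b = 1 /\ c = 0 | b = 0 /\ c = 0]) ->
  normalizable (mx2 x 0 0 y) (mx2 a b c d).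
Proof.
rewrite -subr_eq0 => nz_xy px pxx pt pad bc_n0 bc_0 A B defA defB.
exists A, B => /=; split; first exact: conjugate_refl.
have detA := SL2_det_mx2 defA; have detB := SL2_det_mx2 defB.
have defbeta : beta (toPSL2 A) = (x - y) ^+ 2.
  by rewrite (beta_mx2 defA) -(mul4_eq1 detA); ring.
have defbeta' : beta (toPSL2 B) = (a + d) ^+ 2 - 4 := beta_mx2 defB.
have defgamma : gamma (toPSL2 A) (toPSL2 B) = - (b * c) * (x - y) ^+ 2.
  rewrite (gamma_mx2 defA defB).
  (* Again the version of the formula weighted with the determinants. *)
  transitivity ((a * d - b * c) * (x + y) ^+ 2 + (x * y - 0 * 0) * (a + d) ^+ 2
    + (x * a + y * d) ^+ 2 - (x + y) * (a + d) * (x * a + y * d)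
    - 4 * ((x * y - 0 * 0) * (a * d - b * c))).
    by rewrite detA detB; ring.
  by ring.
have nz_beta : (x - y) ^+ 2 != 0 by rewrite expf_eq0.
have two_n0 : (2 : C) != 0 by rewrite pnatr_eq0.
constructor 1; rewrite /case1_form defbeta defbeta' defgamma mulfK //.
rewrite subrK pt.
have -> : (4 * (- (b * c) * (x - y) ^+ 2) + (x - y) ^+ 2 * ((a + d) ^+ 2 - 4))
   / (x - y) ^+ 2 = (a - d) ^+ 2.
  by rewrite -[X in _ * (_ - X)](mul4_eq1 detB); field.
have -> : (x - y) ^+ 2 * ((x - y) ^+ 2 + 4) = (x ^+ 2 - y ^+ 2) ^+ 2.
  by rewrite -(mul4_eq1 detA); ring.
rewrite pad px pxx; split=> //; split.
  by rewrite defA; congr mx2; field; rewrite ?nz_xy ?two_n0.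
exists b, c; split; first by rewrite defB; congr mx2; field.
rewrite mulf_eq0 oppr_eq0 (negPf nz_beta) orbF; split.
  by case/bc_n0=> pc defb; rewrite defb -mulNr defb -expr2 pc.
by move/eqP; rewrite mulf_eq0 oppr_eq0 (negPf nz_beta) orbF => /eqP.
Qed.

(** Here gamma = c^2 and beta' + 4 = d^2, and the determinant gives b. *)
Lemma normalizable_case2 (b c d : C) :
    c != 0 -> principal c -> principal d ->
  normalizable (mx2 1 1 0 1) (mx2 0 b c d).
Proof.
move=> nz_c pc pd A B defA defB.
exists A, B => /=; split; first exact: conjugate_refl.
have detB := SL2_det_mx2 defB.
have defgamma : gamma (toPSL2 A) (toPSL2 B) = c ^+ 2.
  by rewrite (gamma_mx2 defA defB); ring.
have beta0 : beta (toPSL2 A) = 0 by rewrite (beta_mx2 defA); ring.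
constructor 2; rewrite /case2_form beta0 defgamma (beta_mx2 defB) add0r.
split=> //; split; first by rewrite expf_eq0.
split; first exact: defA.
rewrite subrK pc pd defB; congr mx2.
have -> : b = (b * c) / c by rewrite mulfK.
by rewrite -mulNr -detB mul0r sub0r opprK.
Qed.

(** Here beta' = (a - d)^2, because a d = 1. *)
Lemma normalizable_case3 (a b d : C) :
    principal (a + d) -> principal (a - d) -> (a != d -> b = 0) ->
  normalizable (mx2 1 1 0 1) (mx2 a b 0 d).
Proof.
move=> pt pad b0 A B defA defB.
exists A, B => /=; split; first exact: conjugate_refl.
have detB := SL2_det_mx2 defB.
have two_n0 : (2 : C) != 0 by rewrite pnatr_eq0.
have gamma0 : gamma (toPSL2 A) (toPSL2 B) = 0.
  by rewrite (gamma_mx2 defA defB); ring.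
have beta0 : beta (toPSL2 A) = 0 by rewrite (beta_mx2 defA); ring.
constructor 3; rewrite /case3_form beta0 gamma0 (beta_mx2 defB).
do 2!split=> //; split; first exact: defA.
rewrite subrK pt.
have -> : (a + d) ^+ 2 - 4 = (a - d) ^+ 2 by rewrite -(mul4_eq1 detB); ring.
exists b; split; last by rewrite expf_eq0 /= subr_eq0.
by rewrite pad defB; congr mx2; field.
Qed.

(** * Reduction of arbitrary pairs *)

(** Conjugation by diag(t, 1/t) with t^2 = u. *)
Lemma normalizable_scale (u x y a b c d : C) : u != 0 ->
    normalizable (mx2 x 0 0 y) (mx2 a (b / u) (c * u) d) ->
  normalizable (mx2 x 0 0 y) (mx2 a b c d).
Proof.
move=> nz_u; have defu := sqr_sqrtc u; set t := sqrt u in defu.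
have nz_t : t != 0 by apply: contraNneq nz_u => t0; rewrite -defu t0 expr0n.
rewrite -defu; apply: (@normalizable_conj t 0 0 t^-1).
- by rewrite mulfV // mul0r subr0.
- by rewrite !mulmx2; congr mx2; ring.
- by rewrite !mulmx2; congr mx2; field.
Qed.

(** The signs are fixed in an order such that later moves do not disturb the
    earlier ones: the moves on f alone do not touch g, and those on
    g only require x and y to be distinct. *)
Lemma normalizable_diag (x y : C) N :
  x != y -> normalizable (mx2 x 0 0 y) N.
Proof.
rewrite [N]mx2_entries; move: (N 0 0) (N 0 1) (N 1 0) (N 1 1) => a b c d nz_xy.
wlog pt : a b c d / principal (a + d).
  move=> W; case: (principal_or_opp (a + d)) => [|pN]; first exact: W.
  by apply: normalizable_oppr; rewrite oppmx2; apply: W; rewrite -opprD.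
wlog pad : x y a b c d nz_xy pt / principal (a - d).
  move=> W; case: (principal_or_opp (a - d)) => [|pN]; first exact: W.
  (* The quarter turn exchanges a with d, hence also x with y. *)
  apply: (@normalizable_conj 0 1 (- 1) 0 _ _ (mx2 y 0 0 x)
                                        (mx2 d (- c) (- b) a)).
  - by ring.
  - by rewrite !mulmx2; congr mx2; ring.
  - by rewrite !mulmx2; congr mx2; ring.
  by apply: W; [rewrite eq_sym|rewrite addrC|rewrite -opprB].
wlog pxx : x y nz_xy / principal (x ^+ 2 - y ^+ 2).
  move=> W; case: (principal_or_opp (x ^+ 2 - y ^+ 2)) => [|pN]; first exact: W.
  (* Inverting f exchanges x and y. *)
  apply: normalizable_invl; rewrite oppr0; apply: W; first by rewrite eq_sym.
  by rewrite -opprB.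
wlog px : x y nz_xy pxx / principal (x - y).
  move=> W; case: (principal_or_opp (x - y)) => [|pN]; first exact: W.
  (* The opposite matrix has the same x ^+ 2 - y ^+ 2. *)
  apply: normalizable_oppl; rewrite oppmx2 oppr0; apply: W.
  - by rewrite eqr_opp.
  - by rewrite !sqrrN.
  - by rewrite opprK addrC -opprB.
have [/eqP|nz_bc] := eqVneq (b * c) 0.
  rewrite mulf_eq0; have [-> _|nz_b /= /eqP ->] := eqVneq b 0.
    have [-> |nz_c] := eqVneq c 0.
      by apply: normalizable_case1 => //; rewrite ?mulr0 ?eqxx //;
         constructor 3.
    apply: (@normalizable_scale c^-1); first by rewrite invr_eq0.
    rewrite mul0r mulfV //; apply: normalizable_case1 => //.
      by rewrite mul0r eqxx.
    by constructor 1.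
  apply: (@normalizable_scale b) => //.
  rewrite mul0r mulfV //; apply: normalizable_case1 => //.
    by rewrite mulr0 eqxx.
  by constructor 2.
have [nz_b nz_c] : b != 0 /\ c != 0.
  by apply/andP; rewrite -negb_or -mulf_eq0.
have defs := sqr_sqrtc (- (b * c)); set s := sqrt _ in defs.
have nz_s : s != 0.
  by apply: contraNneq nz_bc => s0; rewrite -oppr_eq0 -defs s0 expr0n.
(* This factor sends c to s, and b to b c / s = - s. *)
apply: (@normalizable_scale (s / c)); first by rewrite mulf_neq0 ?invr_eq0.
have -> : b / (s / c) = - s.
  transitivity (- (- (b * c) / s)); last by rewrite -defs expr2 mulfK.
  by field; rewrite nz_s nz_c.
rewrite [c * _]mulrC divfK //.
apply: normalizable_case1 => //.
  by rewrite opprK; split=> //; apply: sqrtc_principal.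
by move/eqP; rewrite mulf_eq0 oppr_eq0 orbb (negPf nz_s).
Qed.

(** Translations commute with the unipotent generator. *)
Lemma normalizable_translate (z a b c d : C) :
    normalizable (mx2 1 1 0 1)
      (mx2 (a - z * c) (z * (a - z * c) + b - z * d) c (c * z + d)) ->
  normalizable (mx2 1 1 0 1) (mx2 a b c d).
Proof.
apply: (@normalizable_conj 1 z 0 1); first by ring.
- by rewrite !mulmx2; congr mx2; ring.
- by rewrite !mulmx2; congr mx2; ring.
Qed.

Lemma normalizable_parabolic N : normalizable (mx2 1 1 0 1) N.
Proof.
rewrite [N]mx2_entries; move: (N 0 0) (N 0 1) (N 1 0) (N 1 1) => a b c d.
wlog pt : a b c d / principal (a + d).
  move=> W; case: (principal_or_opp (a + d)) => [|pN]; first exact: W.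
  by apply: normalizable_oppr; rewrite oppmx2; apply: W; rewrite -opprD.
have [->|nz_c] := eqVneq c 0.
  wlog pad : a b d pt / principal (a - d).
    move=> W; case: (principal_or_opp (a - d)) => [|pN]; first exact: W.
    (* Inverting g exchanges a and d. *)
    apply: normalizable_invr; rewrite oppr0.
    by apply: W; [rewrite addrC|rewrite -opprB].
  have [ad|nz_ad] := eqVneq a d.
    by apply: normalizable_case3 => //; rewrite ad eqxx.
  (* This translation moves the finite fixed point of g to 0. *)
  apply: (@normalizable_translate (- b / (a - d))).
  rewrite mulr0 subr0 mul0r add0r.
  apply: normalizable_case3 => // _.
  by field; rewrite subr_eq0.
wlog pc : a b c d pt nz_c / principal c.
  move=> W; case: (principal_or_opp c) => [|pN]; first exact: W.
  (* Inverting g changes c into - c and keeps a + d. *)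
  by apply: normalizable_invr; apply: W; rewrite ?oppr_eq0 // addrC.
(* This translation takes the image a / c of infinity under g to 0. *)
apply: (@normalizable_translate (a / c)).
rewrite divfK // subrr [c * _]mulrC divfK //.
exact: normalizable_case2.
Qed.

(** If a <> d, the finite fixed point of f is sent to 0, which makes f diagonal.
    If a = d, the determinant forces a = 1 or a = - 1, and a dilation takes the
    upper right entry of the matrix or of its opposite to 1. *)
Lemma normalizable_upper (a b d : C) N :
  (a != d) || (b != 0) -> normalizable (mx2 a b 0 d) N.
Proof.
have [ad /= nz_b|nz_ad _] := eqVneq a d; last first.
  have nz_ad' : a - d != 0 by rewrite subr_eq0.
  apply: (@normalizable_conjl 1 (- b / (a - d)) 0 1 _ (mx2 a 0 0 d)).
  - by ring.
  - by rewrite !mulmx2; congr mx2; field.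
  by move=> N'; apply: normalizable_diag.
rewrite ad [N]mx2_entries; apply: normalizable_det; rewrite -mx2_entries => + _.
move/eqP; rewrite mulr0 subr0 -expr2 sqrf_eq1.
have parab e M : e != 0 -> normalizable (mx2 1 e 0 1) M.
  move=> nz_e; have defe := sqr_sqrtc e; set t := sqrt e in defe.
  have nz_t : t != 0 by apply: contraNneq nz_e => t0; rewrite -defe t0 expr0n.
  apply: (@normalizable_conjl t 0 0 t^-1 _ (mx2 1 1 0 1)).
  - by rewrite mulfV // mul0r subr0.
  - by rewrite -defe !mulmx2; congr mx2; field.
  by move=> N'; apply: normalizable_parabolic.
case/orP=> /eqP ->; first exact: parab.
apply: normalizable_oppl; rewrite oppmx2 opprK oppr0.
by apply: parab; rewrite oppr_eq0.
Qed.

(** When c <> 0, an eigenvalue m + d has eigenvector (m, c), which is completed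
    to a basis of determinant 1.  The choice of (- 1 / c, 0) makes the upper
    right entry of the triangular matrix nonzero, which excludes the
    trivial matrices. *)
Lemma normalizable_nontrivial M N :
  M <> 1%:M -> M <> - 1%:M -> normalizable M N.
Proof.
rewrite [M]mx2_entries; move: (M 0 0) (M 0 1) (M 1 0) (M 1 1) => a b c d.
move=> neq1 neqN1.
have [c0|nz_c] := eqVneq c 0.
  rewrite c0 in neq1 neqN1 *.
  rewrite [N]mx2_entries; apply: normalizable_det.
  rewrite -mx2_entries => det1 _; apply: normalizable_upper.
  rewrite -negb_and; apply/andP => -[/eqP ad /eqP b0].
  have def1 : 1%:M = mx2 1 0 0 1 :> 'M[C]_2 by rewrite [LHS]mx2_entries !mxE.
  move/eqP: det1; rewrite ad mulr0 subr0 -expr2 sqrf_eq1; case/orP=> /eqP d1.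
    by apply: neq1; rewrite ad b0 d1 def1.
  by apply: neqN1; rewrite ad b0 d1 def1 oppmx2 oppr0.
(* m solves m^2 - (a - d) m - b c = 0, the characteristic equation of m + d. *)
have defs := sqr_sqrtc ((a - d) ^+ 2 + 4 * (b * c)); set s := sqrt _ in defs.
have two_n0 : (2 : C) != 0 by rewrite pnatr_eq0.
pose m := ((a - d) + s) / 2.
have char_m : m ^+ 2 = (a - d) * m + b * c.
  transitivity (((a - d) ^+ 2 + 2 * (a - d) * s + s ^+ 2) / 4).
    by rewrite /m; field.
  by rewrite defs /m; field.
apply: (@normalizable_conjl m (- c^-1) c 0 _ (mx2 (m + d) (- c^-1) 0 (a - m))).
- by rewrite mulr0 sub0r mulNr opprK mulVf.
- rewrite !mulmx2; congr mx2.
  + by rewrite mulr0 addr0 mulrDr -expr2 char_m; ring.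
  + by field.
  + by ring.
  + by field.
by move=> N'; apply: normalizable_upper; rewrite oppr_eq0 invr_eq0 nz_c orbT.
Qed.

End NormalForm.

Theorem theorem4p1 (R : realType) (H : set (PSL2 R[i])) :
  (exists f0 g0 : PSL2 R[i], f0 <> 1%g /\ g0 <> 1%g /\ H = gen2 f0 g0) ->
  exists (f g : PSL2 R[i]) (A B : SL2 R[i]),
    f = toPSL2 A /\ g = toPSL2 B /\ conjugate H (gen2 f g) /\
    [\/ beta f != 0 /\ case1_form A B (beta f) (beta g) (gamma f g),
        beta f = 0 /\ gamma f g != 0 /\ case2_form A B (beta g) (gamma f g)
      | beta f = 0 /\ gamma f g = 0 /\ case3_form A B (beta g)].
Proof.
case=> f0 [g0 [f0_n1 [_ ->]]].
have [||A [B [conjAB formAB]]] :=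
    @normalizable_nontrivial R (repr f0) (repr g0) _ _ _ _ erefl erefl.
- move=> f01; apply: f0_n1; rewrite -(reprPSL2K f0); congr toPSL2.
  exact: val_inj.
- move=> f0N1; apply: f0_n1; rewrite -(reprPSL2K f0) -toPSL2_opp; congr toPSL2.
  by apply: val_inj; rewrite /= f0N1 opprK.
by rewrite !reprPSL2K in conjAB; exists (toPSL2 A), (toPSL2 B), A, B.
Qed.
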